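(* Let $p,n\in\mathbb N$ with $p\ge n-1\ge 4$, and write $p=k(n-1)+r$ with $k\in\mathbb N$ and $r\in\{0,1,\ldots,n-2\}$. Then $$ex(p;T_n^2)=\max\Big\{\Big[\tfrac{(n-2)p}{2}\Big]-(n-1+r),\ \tfrac{(n-2)p-r(n-1-r)}{2}\Big\},$$ and explicitly $$ex(p;T_n^2)=\begin{cases}\big[\tfrac{(n-2)p}{2}\big]-(n-1+r) & \text{if } n\ge 16 \text{ and } 3\le r\le n-6, \text{ or if } 13\le n\le 15 \text{ and } 4\le r\le n-7,\\[2pt] \tfrac{(n-2)p-r(n-1-r)}{2} & \text{otherwise.}\end{cases}$$
   Context: All graphs are finite and simple; a graph ''contains'' $H$ if it has a subgraph isomorphic to $H$. $\mathbb N=\{1,2,3,\ldots\}$ and $[x]$ denotes the greatest integer not exceeding $x$. For a graph $L$ and $p\in\mathbb N$, $ex(p;L)$ is the maximum number of edges in a graph on $p$ vertices that contains no copy of $L$. For $n\ge 5$, $T_n^2$ is the tree with vertex set $\{v_0,v_1,\ldots,v_{n-1}\}$ and edge set $\{v_0v_1,v_0v_2,\ldots,v_0v_{n-3},\,v_{n-3}v_{n-2},\,v_{n-3}v_{n-1}\}$. *)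

(* Defs.v *)
From HB Require Import structures.
From mathcomp Require Import all_boot all_order all_algebra.
Set Implicit Arguments. Unset Strict Implicit. Unset Printing Implicit Defensive.

(* A simple graph on the vertex set 'I_p is encoded by its edge set
   E : {set 'I_p * 'I_p}, each edge {u,v} stored exactly once as the
   ordered pair (u,v) with u < v.  Its number of edges is #|E|. *)
Definition simple_graph (p : nat) (E : {set 'I_p * 'I_p}) : bool :=
  [forall x in E, (x.1 < x.2)%N].

Definition adj (p : nat) (E : {set 'I_p * 'I_p}) (u v : 'I_p) : bool :=
  ((u, v) \in E) || ((v, u) \in E).

Definition contains (p m : nat) (G : {set 'I_p * 'I_p}) (L : {set 'I_m * 'I_m})
  : bool :=
  [exists f : {ffun 'I_m -> 'I_p},
     injectiveb f && [forall x in L, adj G (f x.1) (f x.2)]].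

Definition ex (p m : nat) (L : {set 'I_m * 'I_m}) : nat :=
  \max_(G : {set 'I_p * 'I_p} | simple_graph G && ~~ contains G L) #|G|.

Definition T2_edge (n i j : nat) : bool :=
  ((i == 0) && (1 <= j <= n - 3)) ||
  ((i == n - 3) && ((j == n - 2) || (j == n - 1))).

Definition T2 (n : nat) : {set 'I_n * 'I_n} :=
  [set x : 'I_n * 'I_n | T2_edge n x.1 x.2].

(* Main.v *)
(* Write N = n - 1 and work inside a graph without T_n^2, deleting vertices and
   inducting on their number. A vertex of degree at least N forces its neighbours
   to have degree at most 2 (degree 1 when N = 4), so N neighbours can be deleted
   at a cost of at most N(N-1)/2 edges; for a vertex v of degree N - 1 the closed
   neighbourhood N[v] can be deleted at the same cost. If the maximal degree is at
   most N - 3, or if it is N - 2 and r = N - 1, the bound is the degree sum.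
   Otherwise let deg v = N - 2 be maximal and S = N[v]; each neighbour of v has at
   most one neighbour outside S. Let U be the set of those u in N(v) that have one
   and still have degree N - 2, hence miss exactly one vertex of S. If #|U| <= 2,
   deleting S is cheap. If #|U| >= 3, either all of U has the same outer neighbour
   w, and S + w can be deleted, or all of U misses the same vertex of S, whose low
   degree makes deleting S cheap. The extremal graphs are disjoint cliques K_N with
   either a K_r or a nearly (N-3)-regular circulant on N + r vertices. *)
Require Import Defs.
From HB Require Import structures.
From mathcomp Require Import all_boot all_order all_algebra.
From mathcomp Require Import zify.
Import Order.TTheory GRing.Theory Num.Theory.
Set Implicit Arguments. Unset Strict Implicit. Unset Printing Implicit Defensive.

(** * Degree sums and the deletion of vertex sets *)

Section Fork.
Variables (T : finType) (e : rel T).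
Hypotheses (e_sym : symmetric e) (e_irr : irreflexive e).

Definition nb (A : {set T}) (x : T) : {set T} := [set y in A | e x y].
Definition vol (A : {set T}) : nat := \sum_(x in A) #|nb A x|.

Lemma card_nbE A x : #|nb A x| = \sum_(y in A) e x y.
Proof.
rewrite -sum1dep_card big_mkcondr /=; apply: eq_bigr => y _.
by case: (e x y).
Qed.

Lemma card_nb_split (A S : {set T}) x : S \subset A ->
  #|nb A x| = #|nb S x| + #|nb (A :\: S) x|.
Proof.
move=> sSA; rewrite !card_nbE (big_setID S) /=.
by move/setIidPr: sSA => ->.
Qed.

Lemma sum_nb_sym (A B : {set T}) :
  \sum_(x in A) #|nb B x| = \sum_(y in B) #|nb A y|.
Proof.
under eq_bigr do rewrite card_nbE.
rewrite exchange_big /=; apply: eq_bigr => y _; rewrite card_nbE.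
by apply: eq_bigr => x _; rewrite e_sym.
Qed.

(** An edge between [S] and [A :\: S] is counted in [vol A] from both ends; by symmetry the count at
    the end outside [S] is moved into [S]. The last sum is thus twice the number of edges lost by
    deleting [S]. *)
Lemma vol_split (A S : {set T}) : S \subset A ->
  vol A = vol (A :\: S) + \sum_(x in S) (#|nb A x| + #|nb (A :\: S) x|).
Proof.
move=> sSA; rewrite /vol (big_setID S) /=; move/setIidPr: (sSA) => ->.
have -> : \sum_(x in A :\: S) #|nb A x| =
    \sum_(x in A :\: S) (#|nb S x| + #|nb (A :\: S) x|).
  by apply: eq_bigr => x _; exact: card_nb_split.
rewrite !big_split /= (sum_nb_sym (A :\: S) S); lia.
Qed.

Lemma sum_leq_const (S : {set T}) (F : T -> nat) c :
  (forall x, x \in S -> F x <= c) -> \sum_(x in S) F x <= #|S| * c.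
Proof. by move=> h; rewrite -sum_nat_const; exact: leq_sum. Qed.

Lemma card_nb_lt (A : {set T}) x : x \in A -> #|nb A x| < #|A|.
Proof.
move=> xA; apply: proper_card; apply/properP; split.
  by apply/subsetP => y; rewrite inE => /andP[].
by exists x => //; rewrite inE e_irr andbF.
Qed.

(* [N] is n - 1: [N - 3] leaves at [v] besides [u] complete a copy of T_n^2. *)
Definition fork_free (N : nat) := forall v u a b,
  e v u -> e u a -> e u b -> uniq [:: v; a; b] ->
  #|[set y | e v y] :\: [set u; a; b]| < N - 3.

(* [q] counts every edge twice, as [vol] does; the two alternatives are twice B
   and twice A, the latter without its floor and with N(N-1) moved across to avoid
   truncated subtraction. *)
Definition turan_bound (N p q : nat) := forall k r, r < N -> p = k * N + r ->
  q <= k * (N * (N - 1)) + r * (r - 1) \/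
  (0 < k /\ q + N * (N - 1) <= k * (N * (N - 1)) + (N - 3) * (N + r)).

Variable N : nat.
Hypotheses (N_ge4 : 4 <= N) (ff : fork_free N).

Lemma fork_freeP (A : {set T}) v u a b :
  e v u -> e u a -> e u b -> uniq [:: v; a; b] ->
  #|nb A v :\: [set u; a; b]| < N - 3.
Proof.
move=> vu ua ub un; apply: leq_ltn_trans (ff vu ua ub un).
by apply/subset_leq_card/setSD/subsetP => y; rewrite !inE => /andP[].
Qed.

Lemma card_setD_seq (X : {set T}) (l : seq T) : #|X| - size l <= #|X :\: [set:: l]|.
Proof.
have := cardsID [set:: l] X.
have /leq_trans /(_ (card_size l)) : #|X :&: [set:: l]| <= #|l|.
  by apply: subset_leq_card; apply/subsetP => y; rewrite !inE => /andP[].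
lia.
Qed.

Lemma card_set3D (X : {set T}) x y z : #|X| - 3 <= #|X :\: [set x; y; z]|.
Proof.
apply: leq_trans (card_setD_seq X [:: x; y; z]) _; apply/subset_leq_card/subsetP => u.
by rewrite !inE orbA.
Qed.

Lemma card_set2D (X : {set T}) x y : #|X| - 2 <= #|X :\: [set x; y]|.
Proof.
apply: leq_trans (card_setD_seq X [:: x; y]) _; apply/subset_leq_card/subsetP => u.
by rewrite !inE.
Qed.

Lemma turan_bound_removeN (A S : {set T}) : N <= #|A| -> S \subset A -> #|S| = N ->
  \sum_(x in S) (#|nb A x| + #|nb (A :\: S) x|) <= N * (N - 1) ->
  turan_bound N #|A :\: S| (vol (A :\: S)) -> turan_bound N #|A| (vol A).
Proof.
move=> NA sSA cS w ih k r rN cA.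
have k0 : 0 < k by case: k cA => //; lia.
rewrite (vol_split sSA).
(* [k] drops by one and [r] stays, so both alternatives fall by exactly [N * (N - 1)]. *)
have cAS : #|A :\: S| = k.-1 * N + r.
  by rewrite cardsDS // cS cA -{1}(prednK k0); lia.
have [h|[k1 h]] := ih _ _ rN cAS.
  by left; case: k k0 {cA cAS} h => // k _ /=; lia.
by right; split => //; case: k k0 {cA cAS k1} h => // k _ /=; lia.
Qed.

(** The pair [(k, r)] becomes [(k - 1, r + 1)], so the clique bound falls by [N * (N - 1) - 2 * r].
    As [r <= N - 2], this is at least [(N - 1) * (N - 2) + 2], which is where the 2 comes from. *)
Lemma turan_bound_remove_pred (A S : {set T}) k r :
  0 < k -> r + 1 < N -> #|A| = k * N + r -> S \subset A -> #|S| = N - 1 ->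
  \sum_(x in S) (#|nb A x| + #|nb (A :\: S) x|) <= (N - 1) * (N - 2) + 2 ->
  turan_bound N #|A :\: S| (vol (A :\: S)) ->
  vol A <= k * (N * (N - 1)) + r * (r - 1) \/
  (0 < k /\ vol A + N * (N - 1) <= k * (N * (N - 1)) + (N - 3) * (N + r)).
Proof.
move=> k0 rN cA sSA cS w ih; rewrite (vol_split sSA).
have cAS : #|A :\: S| = k.-1 * N + r.+1.
  rewrite cardsDS // cS cA -{1}(prednK k0) mulSn.
  by move: (k.-1 * N) => m; move: N_ge4; clear; lia.
have rN' : r.+1 < N by lia.
case: N N_ge4 rN rN' cA cS w ih cAS => [|[|[|M]]] // M0 rN rN' cA cS w ih cAS.
have [h|[k1 h]] := ih _ _ rN' cAS; [left|right; split => //];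
  move: w h; rewrite !(subSS, subn0) => w h.
  case: k k0 {cA cAS cS ih} h => // k _ /= h.
  by case: r rN' rN h => [|r]; rewrite ?(subSS, subn0); lia.
by case: k k0 {cA cAS k1 cS ih} h => // k _ /= h; lia.
Qed.

Lemma turan_bound_big_degree (A : {set T}) x : x \in A -> N <= #|nb A x| ->
  (forall B : {set T}, #|B| < #|A| -> turan_bound N #|B| (vol B)) ->
  turan_bound N #|A| (vol A).
Proof.
move=> xA dx ih.
have [S [sS cS]] : exists S : {set T}, S \subset nb A x /\ #|S| = N.
  exists [set y in take N (enum (nb A x))]; split.
    by apply/subsetP => y; rewrite inE => /mem_take; rewrite mem_enum.
  by rewrite cardsE; move/card_uniqP: (take_uniq N (enum_uniq (mem (nb A x)))) => ->;
     rewrite size_takel // -cardE.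
have sSA : S \subset A.
  by apply: subset_trans sS _; apply/subsetP => y; rewrite inE => /andP[].
have NA : N <= #|A| by rewrite -cS; exact: subset_leq_card.
apply: (turan_bound_removeN NA sSA cS); last first.
  by apply: ih; rewrite cardsDS //; lia.
(* The summand of [u] is at most twice its degree and should not exceed [N - 1]: degree 2 is
   affordable unless [N = 4], where degree 1 is needed. *)
have degS (u : T) : u \in S -> #|nb A u| <= if N == 4 then 1 else 2.
  move=> uS; have := subsetP sS _ uS; rewrite inE => /andP[uA xu].
  have ux : e u x by rewrite e_sym.
  have := cardsD1 x (nb A u); rewrite inE xA ux /= => cu.
  case: ifP => [/eqP N4|_]; rewrite leqNgt; apply/negP => lt.
    (* For [N = 4] the fork is read from its other end: [u] is the centre with the single leaf [w],
       and [x] carries [a] and [b]. *)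
    have /card_gt0P[w] : 0 < #|nb A u :\ x| by lia.
    rewrite !inE => /and3P[wx wA uw].
    have : 1 < #|nb A x :\: [set u; w; w]|.
      rewrite -setUA setUid; apply: leq_trans (card_set2D _ _ _).
      by move: dx; rewrite N4; clear; lia.
    case/card_gt1P => a [b [ha hb ab]].
    move: ha hb; rewrite !inE !negb_or -!andbA => /and5P[au aw _ aA xa] /and5P[bu bw _ bA xb].
    have un : uniq [:: u; a; b] by rewrite /= !inE negb_or (eq_sym u) (eq_sym u) au bu ab.
    have := fork_freeP A ux xa xb un; rewrite N4 ltnS leqn0 => /eqP/cards0_eq.
    move/setP/(_ w); rewrite !inE wA uw (negPf wx) (eq_sym w) (negPf aw).
    by rewrite (eq_sym w) (negPf bw).
  have /card_gt1P[a [b [ha hb ab]]] : 1 < #|nb A u :\ x| by lia.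
  move: ha hb; rewrite !inE => /and3P[ax aA ua] /and3P[bx bA ub].
  have un : uniq [:: x; a; b].
    by rewrite /= !inE negb_or (eq_sym x) (eq_sym x) ax bx ab.
  have := fork_freeP A xu ua ub un.
  by move: dx (card_set3D (nb A x) u a b); clear; lia.
rewrite -[X in _ <= X * _]cS; apply: sum_leq_const => u uS.
have := degS _ uS; have := card_nb_split u sSA.
by case: eqP; lia.
Qed.

Lemma closed_nb_sub (A : {set T}) x : x \in A -> x |: nb A x \subset A.
Proof.
move=> xA; apply/subsetP => y; rewrite !inE => /orP[/eqP->//|/andP[]//].
Qed.

Lemma card_closed_nb (A : {set T}) x : #|x |: nb A x| = #|nb A x|.+1.
Proof. by rewrite cardsU1 inE e_irr andbF. Qed.

Lemma nb_closed_out (A : {set T}) x : nb (A :\: (x |: nb A x)) x = set0.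
Proof. by apply/setP => y; rewrite !inE; case: (y \in A); case: (e x y); rewrite ?orbT ?andbF. Qed.

Lemma turan_bound_degree_pred (A : {set T}) x : x \in A -> #|nb A x| = N - 1 ->
  (forall B : {set T}, #|B| < #|A| -> turan_bound N #|B| (vol B)) ->
  turan_bound N #|A| (vol A).
Proof.
move=> xA dx ih; pose S := x |: nb A x.
have sSA : S \subset A by exact: closed_nb_sub.
have cS : #|S| = N by rewrite card_closed_nb dx; lia.
have NA : N <= #|A| by rewrite -cS; exact: subset_leq_card.
apply: (turan_bound_removeN NA sSA cS); last first.
  by apply: ih; rewrite cardsDS //; lia.
rewrite -[X in _ <= X * _]cS; apply: sum_leq_const => u; rewrite !inE.
case/orP => [/eqP->|/andP[uA xu]]; first by rewrite nb_closed_out cards0 dx addn0.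
have ux : e u x by rewrite e_sym.
have split_u := card_nb_split u sSA.
have uS : u \in S by rewrite !inE uA xu orbT.
have xSu : 0 < #|nb S u| by apply/card_gt0P; exists x; rewrite !inE eqxx ux.
have lt_u := card_nb_lt uS.
case: (posnP #|nb (A :\: S) u|) split_u => [->|out] split_u; first by lia.
(* One of these neighbours is [x], so at most one lies outside [S] and the summand is at most 3. *)
suff : #|nb A u| <= 2 by lia.
case/card_gt0P: out => a; rewrite !inE negb_or => /andP[/andP[/andP[ax nxa] aA] ua].
rewrite leqNgt; apply/negP => lt.
have /card_gt0P[b] : 0 < #|nb A u :\: [set x; a; a]|.
  rewrite -setUA setUid; apply: leq_trans (card_set2D _ _ _).
  by move: lt; clear; lia.
rewrite !inE !negb_or -!andbA => /and5P[bx ba _ bA ub].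
have un : uniq [:: x; a; b].
  by rewrite /= !inE negb_or (eq_sym x) (eq_sym x) (eq_sym a b) ax bx ba.
have := fork_freeP A xu ua ub un.
(* [a] is not a neighbour of [x], so excluding it loses no leaf and [N - 3] of them survive. *)
have : nb A x :\: [set u; b] \subset nb A x :\: [set u; a; b].
  apply/subsetP => y; rewrite !inE !negb_or -!andbA => /and4P[-> -> yA xy].
  rewrite yA xy /= andbT; apply: contraNneq nxa => <-; by rewrite yA xy.
move/subset_leq_card.
by move: (card_set2D (nb A x) u b); rewrite dx; move: N_ge4; clear; lia.
Qed.

(** Read [w] as outer neighbour and [x] as missed vertex. If [w a != w b], every vertex differs from
    [a] or from [b] under [w]. When [x a = b], a third vertex breaks the pairing of [a] with [b];
    hence [x a = x b], a value that cannot lie in [U] and that spreads to all of [U]. *)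
Lemma twin_dichotomy (U : {set T}) (w x : T -> T) :
  (forall a, a \in U -> x a != a) ->
  (forall a b, a \in U -> b \in U -> x a = b -> x b = a) ->
  (forall a b, a \in U -> b \in U -> w a != w b -> x a = b \/ x a = x b) ->
  2 < #|U| ->
  (exists w0, forall u, u \in U -> w u = w0) \/
  (exists2 x0, x0 \notin U & forall u, u \in U -> x u = x0).
Proof.
move=> xirr xinv twin U3.
have [/existsP[a /andP[aU /existsP[b /andP[bU wab]]]]|same] :=
  boolP [exists a, (a \in U) && [exists b, (b \in U) && (w a != w b)]]; last first.
  left; have /card_gt0P[a aU] : 0 < #|U| by move: U3; clear; lia.
  exists (w a) => u uU; apply/eqP; apply: contraNT same => wu.
  by apply/existsP; exists u; rewrite uU; apply/existsP; exists a; rewrite aU.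
right; have [xa|xab] := twin _ _ aU bU wab.
  have xb := xinv _ _ aU bU xa.
  have /card_gt0P[c] : 0 < #|U :\: [set a; b]|.
    by apply: leq_trans (card_set2D _ _ _); move: U3; clear; lia.
  rewrite !inE negb_or => /andP[/andP[ca cb] cU].
  have [wca|wca] := eqVneq (w c) (w a); last first.
    rewrite eq_sym in wca; have [xc|xc] := twin _ _ aU cU wca.
      by move: cb; rewrite -xc xa eqxx.
    have xcb : x c = b by rewrite -xc.
    by move: ca; rewrite -(xinv _ _ cU bU xcb) xb eqxx.
  rewrite -wca in wab; rewrite eq_sym in wab.
  have [xc|xc] := twin _ _ bU cU wab.
    by move: ca; rewrite -xc xb eqxx.
  have xca : x c = a by rewrite -xc.
  by move: cb; rewrite -(xinv _ _ cU aU xca) xa eqxx.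
have x0U : x a \notin U.
  apply/negP => xU; have E1 := xinv _ _ aU xU erefl.
  have := xinv _ _ bU xU (esym xab); rewrite E1 => ab.
  by rewrite ab eqxx in wab.
exists (x a) => // u uU; have [wua|wua] := eqVneq (w u) (w a).
  rewrite -wua in wab; have [xu|xu] := twin _ _ uU bU wab; last by rewrite xu -xab.
  have := xinv _ _ uU bU xu => xbu; by rewrite -xab in xbu; rewrite xbu uU in x0U.
rewrite eq_sym in wua; have [xu|//] := twin _ _ aU uU wua.
by rewrite xu uU in x0U.
Qed.

Lemma card1_pick (B : {set T}) (u : T) : #|B| = 1 -> B = [set odflt u [pick x in B]].
Proof.
move=> /eqP/cards1P[y ->]; case: pickP => [z|/(_ y)]; last by rewrite inE eqxx.
by rewrite inE => /eqP->.
Qed.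

(** * Deletions around a vertex of maximal degree N - 2 *)

Section Saturated.
Variables (A : {set T}) (v : T).
Hypotheses (vA : v \in A) (dv : #|nb A v| = N - 2).
Hypothesis dA : forall x, x \in A -> #|nb A x| <= N - 2.
Let S := v |: nb A v.
Let U := [set u in nb A v | (#|nb (A :\: S) u| == 1) && (#|nb A u| == N - 2)].
(** The outer neighbour of [u] and, next, the vertex of [S] that [u] misses. On [U] both sets are
    singletons, so the default [u] is not taken there. *)
Let w u := odflt u [pick x in nb (A :\: S) u].
Let x u := odflt u [pick x in (S :\ u) :\: nb S u].

Let sSA : S \subset A. Proof. exact: closed_nb_sub. Qed.
Let cS : #|S| = N - 1.
Proof. by rewrite card_closed_nb dv; move: N_ge4; clear; lia. Qed.

Let sUS : U \subset S.
Proof. by apply/subsetP => y; rewrite !inE => /andP[-> _]; rewrite orbT. Qed.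

(** Outer neighbours [a], [b] of [u] are not adjacent to [v], so all [N - 3] neighbours of [v] other
    than [u] would serve as leaves. *)
Let out_le1 u : u \in nb A v -> #|nb (A :\: S) u| <= 1.
Proof.
move=> uv; rewrite leqNgt; apply/negP => /card_gt1P[a [b []]].
rewrite !inE !negb_or => /andP[/andP[/andP[av nav] aA] ua].
move=> /andP[/andP[/andP[bv nbv] bA] ub] ab.
have := uv; rewrite inE => /andP[uA vu].
have un : uniq [:: v; a; b].
  by rewrite /= !inE negb_or (eq_sym v) (eq_sym v) av bv ab.
have := fork_freeP A vu ua ub un.
have : nb A v :\ u \subset nb A v :\: [set u; a; b].
  apply/subsetP => y; rewrite !inE => /and3P[yu yA vy]; rewrite yA vy (negPf yu) /=.
  rewrite andbT negb_or; apply/andP; split; [apply: contraNneq nav|apply: contraNneq nbv].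
    by move=> <-; rewrite yA.
  by move=> <-; rewrite yA.
move/subset_leq_card; have := cardsD1 u (nb A v); rewrite uv dv.
by move: N_ge4; clear; lia.
Qed.

Let wE u : u \in U -> nb (A :\: S) u = [set w u].
Proof. by rewrite inE => /and3P[_ /eqP c1 _]; exact: card1_pick. Qed.

(** Of the [N - 2] neighbours of [u] one is outer, so [u] is adjacent to [N - 3] of the [N - 2]
    vertices of [S :\ u]. *)
Let xE u : u \in U -> (S :\ u) :\: nb S u = [set x u].
Proof.
move=> uU; apply: card1_pick; have uS := subsetP sUS _ uU.
have := uU; rewrite inE => /and3P[_ /eqP c1 /eqP du].
have s2 : nb S u \subset S :\ u.
  apply/subsetP => y; rewrite !in_setD1 inE => /andP[-> uy]; rewrite andbT.
  by apply: contraTneq uy => ->; rewrite e_irr.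
rewrite cardsDS //; have := card_nb_split u sSA; have := cardsD1 u S.
by rewrite c1 du uS cS; move: N_ge4; clear; lia.
Qed.

Let xP u : u \in U -> [/\ x u \in S, x u != u & ~~ e u (x u)].
Proof.
move=> uU; have : x u \in [set x u] by rewrite inE.
rewrite -(xE uU) in_setD in_setD1 inE => /andP[+ /andP[-> xS]].
by rewrite xS.
Qed.

Let x_uniq u y : u \in U -> y \in S -> y != u -> ~~ e u y -> y = x u.
Proof.
move=> uU yS yu uy; have : y \in (S :\ u) :\: nb S u.
  by rewrite in_setD in_setD1 inE yu yS (negPf uy).
by rewrite (xE uU) inE => /eqP.
Qed.

(* If a and b are adjacent, then b reaches outside N[a] both at the vertex
   missed by a and at its own outer neighbour, unless these are shared. *)
Let twins a b : a \in U -> b \in U -> w a != w b -> x a = b \/ x a = x b.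
Proof.
move=> aU bU wab; have [xaS xaa axa] := xP aU.
have ab : a != b by apply: contraNneq wab => ->.
have [eab|nab] := boolP (e a b); last first.
  by left; apply/esym/x_uniq => //; [exact: (subsetP sUS)|rewrite eq_sym].
have xab : x a != b by apply: contraNneq axa => ->.
have [ebx|nbx] := boolP (e b (x a)); last by right; exact: x_uniq.
have : w b \in nb (A :\: S) b by rewrite (wE bU) inE.
rewrite inE in_setD -andbA => /and3P[wbS wbA ebw].
have aS := subsetP sUS _ aU; have bS := subsetP sUS _ bU.
have naw : ~~ e a (w b).
  apply: contra wab => eaw; have : w b \in nb (A :\: S) a by rewrite inE in_setD wbS wbA.
  by rewrite (wE aU) inE eq_sym.
have un : uniq [:: a; x a; w b].
  rewrite /= !inE negb_or eq_sym xaa /= andbT; apply/andP; split.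
    by apply: contraNneq wbS => <-.
  by apply: contraNneq wbS => <-.
have := fork_freeP A eab ebx ebw un.
have : nb A a :\ b \subset nb A a :\: [set b; x a; w b].
  apply/subsetP => y; rewrite !inE => /and3P[yb yA ay]; rewrite yA ay (negPf yb) /= andbT.
  by rewrite negb_or; apply/andP; split; apply: contraTneq ay => ->.
move/subset_leq_card; have := cardsD1 b (nb A a).
have := aU; rewrite inE => /and3P[_ _ /eqP ->].
have -> : b \in nb A a by rewrite inE eab (subsetP sSA).
by move: N_ge4; clear; lia.
Qed.

Let weight u := #|nb A u| + #|nb (A :\: S) u|.

(** The degree is at most [N - 2] and at most one neighbour is outer; both extremes together mean
    membership in [U]. *)
Let weight_le u : u \in S -> weight u <= N - 2 + (u \in U).
Proof.
rewrite in_setU1 /weight => /orP[/eqP->|uv].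
  by rewrite nb_closed_out cards0 dv addn0 leq_addr.
have uA : u \in A by move: uv; rewrite inE => /andP[].
rewrite [u \in U]inE uv /=; have := out_le1 uv; have := dA uA.
by case: (#|nb (A :\: S) u| =P 1); case: (#|nb A u| =P N - 2) => /=; clear; lia.
Qed.

Let sum_weight : \sum_(u in S) weight u <= (N - 1) * (N - 2) + #|U|.
Proof.
apply: leq_trans (leq_sum _ weight_le) _.
rewrite big_split /= sum_nat_const cS leq_add2l -big_mkcondr sum1_card.
by apply/subset_leq_card/subsetP => y /= /andP[].
Qed.

Lemma saturated_removal :
  (exists S' : {set T}, [/\ S' \subset A, #|S'| = N - 1 &
     \sum_(u in S') (#|nb A u| + #|nb (A :\: S') u|) <= (N - 1) * (N - 2) + 2]) \/
  (exists S' : {set T}, [/\ S' \subset A, #|S'| = N &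
     \sum_(u in S') (#|nb A u| + #|nb (A :\: S') u|) <= N * (N - 1)]).
Proof.
have [U2|U3] := leqP #|U| 2.
  left; exists S; split => //; apply: leq_trans sum_weight _.
  by rewrite leq_add2l.
have [] // := @twin_dichotomy U w x.
- by move=> a aU; case: (xP aU).
- move=> a b aU bU xab; have [_ xaa axa] := xP aU.
  apply/esym/x_uniq => //; first exact: (subsetP sUS).
    by rewrite -xab eq_sym.
  by rewrite e_sym -xab.
- move=> [w0 w0E]; right.
  have w0P u : u \in U -> [/\ w0 \in A, w0 \notin S & e u w0].
    move=> uU; have : w0 \in nb (A :\: S) u by rewrite (wE uU) inE w0E.
    by rewrite inE in_setD => /andP[/andP[-> ->]].
  have /card_gt0P[u0 u0U] : 0 < #|U| by move: U3; clear; lia.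
  have [w0A w0S _] := w0P _ u0U.
  have sS' : w0 |: S \subset A by rewrite subUset sub1set w0A.
  exists (w0 |: S); split => //.
    by rewrite cardsU1 w0S cS; move: N_ge4; clear; lia.
  have w0D : [set w0] \subset A :\: S by rewrite sub1set in_setD w0S w0A.
  have D : (A :\: S) :\: [set w0] = A :\: (w0 |: S) by rewrite setDDl setUC.
  (* [S] is deleted first, then [w0]. The second deletion adds at most twice the degree of [w0]
     outside [S], hence at most [2 * (N - 2 - #|U|)], which absorbs the excess [#|U|] of the
     first. *)
  have := vol_split sS'; rewrite (vol_split sSA) (vol_split w0D) big_set1 D.
  have := sum_weight; rewrite /weight.
  have : #|nb (A :\: S) w0| + #|U| <= N - 2.
    apply: leq_trans (dA w0A); rewrite (card_nb_split w0 sSA) addnC leq_add2r.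
    apply/subset_leq_card/subsetP => u uU; rewrite inE (subsetP sUS) // e_sym.
    by case: (w0P _ uU).
  have : #|nb (A :\: (w0 |: S)) w0| <= #|nb (A :\: S) w0|.
    by rewrite -D; apply/subset_leq_card/subsetP => y; rewrite !inE => /andP[/andP[_ ->] ->].
  have : (N - 1) * (N - 2) + 2 * (N - 2) <= N * (N - 1).
    by case: N N_ge4 => [|[|[|M]]] // _; rewrite !(subSS, subn0); lia.
  move: N_ge4 U3; clear; lia.
move=> [x0 x0U x0E]; left; exists S; split => //.
have /card_gt0P[u0 u0U] : 0 < #|U| by move: U3; clear; lia.
have [x0S _ nx0] := xP u0U; rewrite (x0E _ u0U) in x0S nx0.
have x0v : x0 \in nb A v.
  move: x0S; rewrite in_setU1 => /orP[/eqP x0v|//].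
  by move: nx0 u0U; rewrite x0v !inE (e_sym u0) => /negPf->; rewrite andbF.
rewrite (big_setD1 x0) //=.
have : \sum_(u in S :\ x0) weight u <= (N - 2) * (N - 2) + #|U|.
  apply: (@leq_trans (\sum_(u in S :\ x0) (N - 2 + (u \in U)))).
    by apply: leq_sum => u; rewrite in_setD1 => /andP[_]; exact: weight_le.
  rewrite big_split /= sum_nat_const -big_mkcondr sum1_card leq_add //.
    rewrite leq_mul2r; apply/orP; right; have := cardsD1 x0 S; rewrite x0S cS.
    by clear; lia.
  by apply/subset_leq_card/subsetP => y /= /andP[].
have := out_le1 x0v; have := card_nb_split x0 sSA.
(* Within [S], [x0] misses itself and all of [U], so its weight is at most [N - #|U|]; this cancels
   the excess [#|U|] of the other vertices and leaves the allowed 2. *)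
have : #|nb S x0| + #|x0 |: U| <= N - 1.
  have sub : x0 |: U \subset S by rewrite subUset sub1set x0S.
  have : nb S x0 \subset S :\: (x0 |: U).
    apply/subsetP => y; rewrite inE in_setD => /andP[yS x0y]; rewrite yS andbT in_setU1 negb_or.
    apply/andP; split; first by apply: contraTneq x0y => ->; rewrite e_irr.
    by apply: contraTN x0y => yU; have [_ _] := xP yU; rewrite (x0E y) // e_sym.
  by move/subset_leq_card; have := subset_leq_card sub; rewrite cardsDS // cS; clear; lia.
rewrite cardsU1 x0U /weight.
have : (N - 1) * (N - 2) = (N - 2) * (N - 2) + (N - 2).
  by case: N N_ge4 => [|[|[|M]]] // _; rewrite !(subSS, subn0); lia.
move: U3 N_ge4; clear; lia.
Qed.
End Saturated.

(** * The induction on the number of vertices *)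

Theorem fork_free_turan_bound (A : {set T}) : turan_bound N #|A| (vol A).
Proof.
have [m] := ubnP #|A|; elim: m A => // m IH A; rewrite ltnS => Am.
have {IH Am} ih (B : {set T}) : #|B| < #|A| -> turan_bound N #|B| (vol B).
  by move=> /leq_trans/(_ Am)/IH.
have [x /andP[xA dx]|small1] := pickP [pred x in A | N <= #|nb A x|].
  exact: turan_bound_big_degree xA dx ih.
have [x /andP[xA /eqP dx]|small2] := pickP [pred x in A | #|nb A x| == N - 1].
  exact: turan_bound_degree_pred xA dx ih.
have dA x : x \in A -> #|nb A x| <= N - 2.
  move=> xA; move: (small1 x) (small2 x) N_ge4; rewrite /= xA /=; clear.
  by case: eqP; lia.
have volA c : (forall x, x \in A -> #|nb A x| <= c) -> vol A <= #|A| * c.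
  exact: sum_leq_const.
move=> k r rN cA.
have [k0|k0] : k = 0 \/ 0 < k by clear; lia.
  left; rewrite k0 in cA *; rewrite !mul0n !add0n in cA *; rewrite -cA.
  by apply: volA => x xA; have := card_nb_lt xA; clear; lia.
have [x /andP[xA /eqP dx]|small3] := pickP [pred x in A | #|nb A x| == N - 2]; last first.
  (* Degree [N - 3] is charged to [N + r] vertices, and the weaker [N - 1] to the other
     [(k - 1) * N]. *)
  right; split => //.
  have /volA : forall x, x \in A -> #|nb A x| <= N - 3.
    move=> x xA; move: (dA x xA) (small3 x) N_ge4; rewrite /= xA /=; clear.
    by case: eqP; lia.
  rewrite cA; case: k k0 {cA} => // k _.
  by case: N N_ge4 rN => [|[|[|M]]] // _ _; rewrite !(subSS, subn0); nia.
have [r1|r1] := ltnP r.+1 N; last first.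
  (* For [r = N - 1] the remainder cannot be raised to [r + 1], but degrees at most [N - 2] already
     give the clique bound. *)
  left; have := volA _ dA; rewrite cA.
  have -> : r = N - 1 by move: r1 rN; clear; lia.
  by case: N N_ge4 => [|[|[|M]]] // _; rewrite !(subSS, subn0); nia.
have [] := saturated_removal xA dx dA.
  move=> [S [sSA cS w]]; apply: (turan_bound_remove_pred k0 _ cA sSA cS w); first by rewrite addn1.
  by apply: ih; rewrite cardsDS // cS cA; move: k0 N_ge4; clear; nia.
move=> [S [sSA cS w]]; have NA : N <= #|A| by rewrite -cS subset_leq_card.
apply: (turan_bound_removeN NA sSA cS w) rN cA.
by apply: ih; rewrite cardsDS // cS; move: NA N_ge4; clear; lia.
Qed.
End Fork.

(** * Edge sets, adjacency and copies of the tree *)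

Section AdjacencyRelation.
Variables (p : nat) (G : {set 'I_p * 'I_p}).
Hypothesis simpleG : simple_graph G.

Lemma simple_lt (x y : 'I_p) : (x, y) \in G -> x < y.
Proof. by move=> xyG; have /forall_inP/(_ _ xyG) := simpleG. Qed.

Lemma adj_sym : symmetric (adj G).
Proof. by move=> x y; rewrite /adj orbC. Qed.

Lemma adj_irr : irreflexive (adj G).
Proof.
by move=> x; rewrite /adj orbb; apply/negP => /simple_lt; rewrite ltnn.
Qed.

End AdjacencyRelation.

Lemma card_edgesE (p : nat) (G : {set 'I_p * 'I_p}) :
  #|G| = \sum_(j < p) \sum_(i < p) ((i, j) \in G).
Proof.
rewrite exchange_big /= pair_big /= -sum1_card big_mkcond /=.
by apply: eq_bigr => -[i j] _ /=; case: (_ \in G).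
Qed.

Lemma vol_adj (p : nat) (G : {set 'I_p * 'I_p}) :
  simple_graph G -> vol (adj G) [set: 'I_p] = 2 * #|G|.
Proof.
move=> simpleG; rewrite /vol mul2n -addnn {1}card_edgesE card_edgesE.
rewrite [X in _ + X]exchange_big /= -big_split /=.
apply: eq_big => [x|x _]; first by rewrite inE.
rewrite card_nbE -big_split /=; apply: eq_big => [y|y _]; first by rewrite inE.
rewrite /adj; case xy: (_ \in G); case yx: (_ \in G) => //.
by have := simple_lt simpleG xy; have := simple_lt simpleG yx; lia.
Qed.

Lemma T2_free_fork_free (n p : nat) (G : {set 'I_p * 'I_p}) :
  4 < n -> simple_graph G -> ~~ contains G (T2 n) -> fork_free (adj G) (n - 1).
Proof.
move=> n5 simpleG free v u a b vu ua ub un; rewrite ltnNge; apply: contra free => big.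
set X := _ :\: _ in big; pose L := take (n - 4) (enum X).
have sL : size L = n - 4 by rewrite size_takel // -cardE; move: big; clear; lia.
have LX y : y \in L -> [/\ adj G v y, y != u, y != a & y != b].
  move=> /mem_take; rewrite mem_enum !inE !negb_or.
  by case/andP => /andP[/andP[yu ya] yb] vy; split.
have Lnth j : j < n - 4 -> nth v L j \in L by rewrite -sL; exact: mem_nth.
(* The order follows the numbering of the tree: [v] at 0, then [n - 4] leaves, [u] at [n - 3], and
   [a], [b] last. *)
pose s := v :: L ++ [:: u; a; b].
have ss : size s = n by rewrite /= size_cat sL /=; move: n5; clear; lia.
have nth_u : nth v s (n - 3) = u.
  have -> : n - 3 = (n - 4).+1 by move: n5; clear; lia.
  by rewrite /= nth_cat sL ltnn subnn.
have nth_a : nth v s (n - 2) = a.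
  have -> : n - 2 = (n - 3).+1 by move: n5; clear; lia.
  rewrite /= nth_cat sL ltnNge leq_sub2l //.
  by have -> : n - 3 - (n - 4) = 1 by move: n5; clear; lia.
have nth_b : nth v s (n - 1) = b.
  have -> : n - 1 = (n - 2).+1 by move: n5; clear; lia.
  rewrite /= nth_cat sL ltnNge leq_sub2l //.
  by have -> : n - 2 - (n - 4) = 2 by move: n5; clear; lia.
have neq_adj y z : adj G y z -> y != z.
  by apply: contraTneq => ->; rewrite adj_irr.
have uniq_s : uniq s.
  move: un; rewrite /= !inE !negb_or => /and3P[/andP[va vb] ab _].
  rewrite mem_cat !inE !negb_or cat_uniq take_uniq ?enum_uniq //= !inE !negb_or va vb ab.
  rewrite (neq_adj _ _ vu) (neq_adj _ _ ua) (neq_adj _ _ ub) /= !andbT.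
  apply/andP; split.
    by apply/negP => /LX[/neq_adj]; rewrite eqxx.
  by apply/and3P; split; apply/negP => /LX[]; rewrite eqxx.
apply/existsP; exists [ffun i : 'I_n => nth v s i]; apply/andP; split.
  apply/injectiveP => i j; rewrite !ffunE => /eqP.
  by rewrite nth_uniq ?ss ?ltn_ord // => /eqP/val_inj.
apply/forall_inP => -[i j]; rewrite inE !ffunE /=.
case/orP => [/andP[/eqP -> /andP[j0 jn]]|/andP[/eqP -> /orP[/eqP->|/eqP->]]].
- case: (val j) j0 jn => // j' _ jn; rewrite [nth v s 0]/= /= nth_cat sL.
  case: ltnP => [/Lnth/LX[]//|jn'].
  by have -> : j' - (n - 4) = 0 by move: jn jn' n5; clear; lia.
- by rewrite nth_u nth_a.
- by rewrite nth_u nth_b.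
Qed.

(** Two necessary conditions, one for each part of the extremal graphs: the degree rules out a copy
    centred in the circulant, the component size one centred in a clique. *)
Lemma T2_copy (n p : nat) (G : {set 'I_p * 'I_p}) :
  4 < n -> contains G (T2 n) -> exists v, n - 3 <= #|nb (adj G) setT v| /\
    forall C : {set 'I_p}, v \in C ->
      (forall x y, x \in C -> adj G x y -> y \in C) -> n <= #|C|.
Proof.
case: n => // n n5 /existsP[f /andP[/injectiveP f_inj /forall_inP fE]].
have f_adj i j : i < n.+1 -> j < n.+1 -> T2_edge n.+1 i j -> adj G (f (inord i)) (f (inord j)).
  by move=> iN jN ij; apply: (fE (inord i, inord j)); rewrite inE /= !inordK.
have centre i : 0 < i -> i < n.-1 -> adj G (f (inord 0)) (f (inord i)).
  by move=> i0 iN; apply: f_adj => //; rewrite /T2_edge; lia.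
exists (f (inord 0)); split.
  pose g (i : 'I_(n - 2)) := f (inord i.+1).
  have g_inj : injective g.
    move=> i j /f_inj /(congr1 val); have := ltn_ord i; have := ltn_ord j => jn i_n.
    rewrite /= !inordK; try by lia.
    by case=> /val_inj.
  rewrite -[_ - 3]card_ord -(card_imset _ g_inj); apply/subset_leq_card/subsetP => y.
  case/imsetP => i _ ->; rewrite !inE /=; apply: centre => //.
  by have := ltn_ord i; lia.
move=> C vC closed; rewrite -[X in X <= _](card_ord n.+1) -(card_imset _ f_inj).
apply/subset_leq_card/subsetP => y /imsetP[i _ ->].
have fC j : 0 < j -> j < n.-1 -> f (inord j) \in C.
  by move=> j0 jn; apply: closed vC _; exact: centre.
rewrite -(inord_val i); case: (posnP i) => [->//|i0].
case: (ltnP i n.-1) => [|ni]; first exact: fC.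
apply: (closed (f (inord (n - 2)))); first by apply: fC; lia.
apply: f_adj => //; try lia.
by have := ltn_ord i; rewrite /T2_edge; lia.
Qed.

(** * The extremal graphs, their edge counts and degrees *)

Lemma sum_interval (a b p : nat) : \sum_(i < p) (a <= i < b) = minn b p - a.
Proof.
elim: p => [|p IH]; first by rewrite big_ord0; lia.
by rewrite big_ord_recr /= IH; lia.
Qed.

(** When blocks of [N] consecutive vertices are cliques, [j] has [j %% N] smaller neighbours; the
    right side is the degree sum of [k] cliques $K_N$ and one $K_r$. *)
Lemma sum_modn (N k r : nat) : 0 < N -> r < N ->
  2 * (\sum_(j < k * N + r) j %% N) = k * (N * (N - 1)) + r * (r - 1).
Proof.
have mul_pred n : n * (n - 1) + n = n * n by case: n => // n; rewrite subn1 /=; lia.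
move=> N0 rN; suff : 2 * (\sum_(j < k * N + r) j %% N) + r + k * N = k * (N * N) + r * r.
  by rewrite -(mul_pred N) -(mul_pred r) mulnDr; lia.
elim: k r rN => [|k IH] r.
  rewrite mul0n add0n; elim: r => [|r IHr] rN; first by rewrite big_ord0.
  by move: (IHr (ltnW rN)); rewrite big_ord_recr /= modn_small //; lia.
elim: r => [|r IHr] rN.
  have lt : N.-1 < N by lia.
  move: (IH _ lt); have -> : k.+1 * N + 0 = (k * N + N.-1).+1 by lia.
  rewrite big_ord_recr /= modnMDl modn_small //; move: (\sum_(_ < _) _) => S.
  by case: N N0 {IH rN lt} => // M _ /=; lia.
move: (IHr (ltnW rN)); rewrite (addnS (k.+1 * N) r) big_ord_recr /= modnMDl modn_small; lia.
Qed.

(* Edges i < j of a circulant on [0, m). For odd [d] the edges {i, i + m/2} are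
   restricted to i < m/2: for odd m this makes them a matching that misses one
   vertex, so that the total is always floor(dm/2). *)
Definition circ_edge (d m i j : nat) : bool :=
  [|| j - i <= d./2, m - d./2 <= j - i | [&& odd d, j == i + m./2 & i < m./2]].

(** Covers both extremal graphs: [M = p] gives cliques only, the last one possibly smaller, while
    [M = (k - 1) * N] leaves [N + r] vertices for the circulant. No edge crosses [M]. *)
Definition blocks_circ (p N M d : nat) : {set 'I_p * 'I_p} :=
  [set x : 'I_p * 'I_p | (x.1 < x.2) &&
    (if x.2 < M then x.1 %/ N == x.2 %/ N
     else (M <= x.1) && circ_edge d (p - M) (x.1 - M) (x.2 - M))].

(** For fixed [j] the smaller neighbours form three disjoint intervals (near, wrapped around, and at
    most one opposite vertex), so a column is counted by interval lengths. *)
Lemma circ_edge_split (d m i j : nat) : d < m -> j < m ->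
  (i < j) && circ_edge d m i j =
  (j - d./2 <= i < j) + (0 <= i < j + d./2.+1 - m) + 
  (j - m./2 <= i < (j - m./2) + (odd d && (m./2 <= j < m./2.*2))) :> nat.
Proof.
move=> dm jm; rewrite /circ_edge /=.
have := odd_double_half d; have := odd_double_half m.
move: (d./2) (m./2) (odd d) (odd m) => h q o o' mE dE.
have hm : h.*2 < m by lia.
have hq : o -> h < q by move=> o1; rewrite o1 in dE; lia.
have qm : q.*2 <= m by lia.
move: hm hq qm jm; clear => hm hq qm jm.
have E1 : (i < j) && (j - i <= h) = (j - h <= i < j) by lia.
have E2 : (i < j) && (m - h <= j - i) = (i < j + h.+1 - m) by lia.
have E3 : (i < j) && [&& o, j == i + q & i < q] =
    (j - q <= i < (j - q) + (o && (q <= j < q.*2))).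
  case: o hq => [/(_ isT) hq|_] /=; last by lia.
  by have [qj|qj] := leqP q j; have [j2|j2] := ltnP j q.*2 => /=; lia.
rewrite !andb_orr E1 E2 E3.
have D12 : (j - h <= i < j) -> (i < j + h.+1 - m) = false by lia.
have D3 : (j - q <= i < (j - q) + (o && (q <= j < q.*2))) ->
   (j - h <= i < j) = false /\ (i < j + h.+1 - m) = false.
  case: o {E3} hq => [/(_ isT) hq|_] /=; last by lia.
  by have [qj|qj] := leqP q j; have [j2|j2] := ltnP j q.*2 => /=; lia.
case: (boolP (j - q <= i < _)) => [/D3[-> ->] //|_].
by case: (boolP (j - h <= i < j)) => [/D12 -> //|_]; rewrite orbF addn0.
Qed.

(** Only an upper bound on the degree is wanted, so a list of length [d] containing all neighbours
    suffices; for odd [d] and [m], the last entry of the unmatched vertex is not a neighbour. *)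
Definition circ_nbrs (d m u : nat) : seq nat :=
  [seq (u + k.+1) %% m | k <- iota 0 d./2] ++
  [seq (u + (m - k.+1)) %% m | k <- iota 0 d./2] ++
  nseq (odd d) (if u < m./2 then u + m./2 else u - m./2).

Lemma size_circ_nbrs d m u : size (circ_nbrs d m u) = d.
Proof.
by rewrite !size_cat !size_map !size_iota size_nseq; have := odd_double_half d; lia.
Qed.

Lemma circ_edge_nbrs d m u w : d < m -> u < m -> w < m ->
  (u < w) && circ_edge d m u w || (w < u) && circ_edge d m w u -> w \in circ_nbrs d m u.
Proof.
move=> dm um wm; have hm : d./2 < m by have := odd_double_half d; lia.
have fwd k : k < d./2 -> u + k.+1 = w \/ u + k.+1 = m + w -> w \in circ_nbrs d m u.
  move=> kh E; rewrite mem_cat; apply/orP; left; apply/mapP; exists k.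
    by rewrite mem_iota.
  by case: E => ->; rewrite ?modnDl modn_small.
have bwd k : k < d./2 -> u + (m - k.+1) = w \/ u + (m - k.+1) = m + w ->
    w \in circ_nbrs d m u.
  move=> kh E; rewrite !mem_cat; apply/orP; right; apply/orP; left; apply/mapP; exists k.
    by rewrite mem_iota.
  by case: E => ->; rewrite ?modnDl modn_small.
rewrite /circ_edge => /orP[/andP[uw /or3P[h|h|/and3P[o /eqP E h]]]|
  /andP[wu /or3P[h|h|/and3P[o /eqP E h]]]].
- by apply: (fwd (w - u).-1); lia.
- by apply: (bwd (m - (w - u)).-1); lia.
- by rewrite !mem_cat o h -E mem_seq1 eqxx !orbT.
- by apply: (bwd (u - w).-1); lia.
- by apply: (fwd (m - (u - w)).-1); lia.
- rewrite !mem_cat o mem_seq1; have -> : (u < m./2) = false by lia.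
  by rewrite E addnK eqxx !orbT.
Qed.

Section BlocksCirc.
Variables (p N M d : nat).
Hypotheses (N_gt0 : 0 < N) (Mp : M <= p) (dm : (d < p - M) || (M == p)).

Lemma simple_blocks_circ : simple_graph (blocks_circ p N M d).
Proof. by apply/forall_inP => x; rewrite inE => /andP[]. Qed.

Lemma blocks_column (j : 'I_p) : j < M ->
  \sum_(i < p) ((i, j) \in blocks_circ p N M d) = j %% N.
Proof.
move=> jM; rewrite (eq_bigr (fun i : 'I_p => nat_of_bool (j %/ N * N <= i < j))).
  rewrite sum_interval; have := ltn_ord j; have := divn_eq j N; lia.
move=> i _; rewrite inE /= jM; congr nat_of_bool.
case: (ltnP i j) => ij; rewrite ?andbF //= andbT.
apply/eqP/idP => [<-|]; first exact: leq_divM.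
by rewrite -leq_divRL // => le; apply/eqP; rewrite eqn_leq le leq_div2r // ltnW.
Qed.

(** The terms are the lengths of the three intervals in [circ_edge_split]. *)
Let circ_count j := minn j d./2 + (j + d./2.+1 - (p - M)) +
  (odd d && ((p - M)./2 <= j < (p - M)./2.*2)).

Lemma circ_column (j : 'I_p) : M <= j ->
  \sum_(i < p) ((i, j) \in blocks_circ p N M d) = circ_count (j - M).
Proof.
move=> jM; have jp := ltn_ord j; rewrite /circ_count.
have dm' : d < p - M by move: dm; lia.
have jm : j - M < p - M by lia.
set m := p - M in dm' jm *; set c := odd d && _.
rewrite (eq_bigr (fun i : 'I_p => (M + (j - M - d./2) <= i < j) +
   (M <= i < M + (j - M + d./2.+1 - m)) +
   (M + (j - M - m./2) <= i < M + (j - M - m./2) + c))).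
  rewrite !big_split /= !sum_interval.
  have : m./2.*2 <= m by have := odd_double_half m; lia.
  have : d./2 < m by have := odd_double_half d; lia.
  have : M + m = p by rewrite /m; lia.
  have : c -> m./2 <= j - M by move=> /andP[_ /andP[]].
  by move: (d./2) (m./2) jM jm jp; clear => h q jM jm jp cq Mm hm qm;
    congr (_ + _ + _); [| |case: c cq => // _]; lia.
move=> i _; rewrite inE /= [j < M]ltnNge jM /=.
have [Mi|iM] := leqP M i => /=; last by move: iM; clear; case: c; lia.
have := circ_edge_split (i - M) dm' jm; rewrite -/m -/c.
have -> : (i - M < j - M) = (i < j) by move: Mi jM; clear; lia.
move=> ->; congr (_ + _ + _); congr nat_of_bool.
- by move: Mi jM; clear; lia.
- by move: Mi jM; clear; lia.
- by move: Mi jM; clear; case: c; lia.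
Qed.

(** Reversing the order in the second term turns it into [d./2 - j], which complements [minn j d./2]
    to the constant [d./2]; the opposite vertices add [m./2] when [d] is odd. *)
Lemma sum_circ_count : \sum_(j < p - M) circ_count j = (d * (p - M)) %/ 2.
Proof.
case/orP: dm => [dm'|/eqP->]; last by rewrite subnn big_ord0 muln0.
rewrite /circ_count; set m := p - M in dm' *.
rewrite !big_split /= -(big_mkord xpredT (fun j => minn j d./2)).
rewrite -(big_mkord xpredT (fun j => j + d./2.+1 - m)) [X in _ + X + _]big_nat_rev -big_split /=.
rewrite (eq_big_nat _ _ (F2 := fun=> d./2)); last by move=> i /andP[_ im]; lia.
rewrite sum_nat_const_nat subn0.
have -> : \sum_(j < m) (odd d && (m./2 <= j < m./2.*2)) = odd d * m./2.
  case: (odd d); last by rewrite big1.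
  by rewrite sum_interval; have := odd_double_half m; lia.
rewrite -{3}(odd_double_half d) mulnDl -doubleMl mulnC.
by move: (_ * _) => X; case: (odd d); rewrite ?mul1n ?mul0n; lia.
Qed.

Lemma card_blocks_circ :
  #|blocks_circ p N M d| = \sum_(j < M) j %% N + (d * (p - M)) %/ 2.
Proof.
rewrite card_edgesE -sum_circ_count.
rewrite (eq_bigr (fun j : 'I_p => if j < M then j %% N else circ_count (j - M))); last first.
  by move=> j _; case: ltnP => jM; [exact: blocks_column|exact: circ_column].
rewrite -(big_mkord xpredT (fun j => if j < M then j %% N else circ_count (j - M))).
rewrite (@big_cat_nat _ _ _ M) //= big_mkord; congr (_ + _).
  by apply: eq_bigr => j _; rewrite ltn_ord.
rewrite -{1}(add0n M) big_addn big_mkord; apply: eq_bigr => j _.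
by rewrite ltnNge leq_addl addnK.
Qed.

Lemma circ_degree (v : 'I_p) : M <= v -> #|nb (adj (blocks_circ p N M d)) setT v| <= d.
Proof.
move=> Mv; have vp := ltn_ord v; have dm' : d < p - M by move: dm; lia.
have nbP w : w \in nb (adj (blocks_circ p N M d)) setT v ->
    M <= w /\ w - M \in circ_nbrs d (p - M) (v - M).
  rewrite !inE /= /adj !inE /=; have wp := ltn_ord w.
  rewrite ![_ < M]ltnNge Mv /=; have [Mw|wM] := leqP M w; rewrite /= ?andbT; last first.
    by rewrite (_ : (v < w) = false) ?andbF //; apply/negbTE; rewrite -leqNgt; lia.
  move=> E; split => //; have lt_sub a b : M <= a -> (a - M < b - M) = (a < b) by lia.
  by apply: circ_edge_nbrs; rewrite ?lt_sub.
rewrite -[X in _ <= X](size_circ_nbrs d (p - M) (v - M)) cardE.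
rewrite -(size_map (fun w : 'I_p => w - M)); apply: uniq_leq_size.
  rewrite map_inj_in_uniq ?enum_uniq // => x y; rewrite !mem_enum => /nbP[Mx _] /nbP[My _].
  by move=> E; apply: val_inj => /=; lia.
by move=> y /mapP[w]; rewrite mem_enum => /nbP[_ wL] ->.
Qed.

Lemma block_component (v : 'I_p) : v < M ->
  exists C : {set 'I_p}, [/\ v \in C, #|C| <= N &
    forall x y, x \in C -> adj (blocks_circ p N M d) x y -> y \in C].
Proof.
move=> vM; exists [set w : 'I_p | (w < M) && (w %/ N == v %/ N)]; split.
- by rewrite inE vM eqxx.
- set C := [set w | _]; pose g (w : 'I_p) : 'I_N := Ordinal (ltn_pmod w N_gt0).
  have g_inj : {in C &, injective g}.
    move=> x y; rewrite !inE => /andP[_ /eqP xv] /andP[_ /eqP yv] [E].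
    by apply: val_inj; rewrite /= (divn_eq x N) (divn_eq y N) xv yv E.
  by rewrite -(card_in_imset g_inj) -[X in _ <= X]card_ord max_card.
move=> x y; rewrite !inE => /andP[xM /eqP xv]; rewrite /adj !inE /= xM xv.
case/orP => /andP[xy]; last by move=> /eqP ->; rewrite (ltn_trans xy xM) eqxx.
by case: ltnP => [yM /eqP <-|yM]; rewrite ?eqxx // leqNgt xM.
Qed.

Lemma blocks_circ_T2_free n : 4 < n -> N < n -> d < n - 3 -> 
  ~~ contains (blocks_circ p N M d) (T2 n).
Proof.
move=> n5 Nn dn; apply/negP => /(T2_copy n5)[v [deg comp]].
have [Mv|vM] := leqP M v.
  by move: (leq_trans deg (circ_degree Mv)); rewrite leqNgt dn.
have [C [vC CN closed]] := block_component vM.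
by move: (leq_trans (comp C vC closed) CN); rewrite leqNgt Nn.
Qed.

End BlocksCirc.

Lemma leq_ex (p m : nat) (L : {set 'I_m * 'I_m}) (G : {set 'I_p * 'I_p}) :
  simple_graph G -> ~~ contains G L -> #|G| <= ex p L.
Proof.
by move=> sG fG; apply: (leq_bigmax_cond (F := fun G : {set _} => #|G|)); rewrite sG.
Qed.

Lemma mul_pred_even n : exists m, n * (n - 1) = 2 * m.
Proof.
by exists 'C(n, 2); rewrite mul2n bin2 subn1 even_halfK // oddM; case: n => //= n; rewrite andNb.
Qed.

(** * The Turan number as a maximum, and which term is larger *)

Section Extremal.
Variables (N k r : nat).
Hypotheses (N_ge4 : 4 <= N) (k_gt0 : 0 < k) (rN : r < N).
Let p := k * N + r.
Let X := (N - 1) * p.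
Let a := X %/ 2 - (N + r).
Let b := (X - r * (N - r)) %/ 2.

(** The division in [b] is exact, because the numerator is a sum of two products of consecutive
    integers. *)
Let doubleb : 2 * b = k * (N * (N - 1)) + r * (r - 1).
Proof.
have Nr : r * (N - r) + r * r = r * N by rewrite -mulnDr subnK // ltnW.
have rr : r * (r - 1) + r = r * r by case: (r) => // r'; rewrite subn1 /=; lia.
have XE : X = k * (N * (N - 1)) + r * (r - 1) + r * (N - r).
  rewrite /X /p; case: N N_ge4 Nr => // M _; rewrite subn1 /=; lia.
rewrite /b XE addnK; have [m ->] := mul_pred_even N; have [m' ->] := mul_pred_even r.
by rewrite mulnCA -mulnDr mulKn.
Qed.

(** Exhibits [a] as half, rounded down, of the degree sum of [k - 1] cliques and an
    [(N - 3)]-regular graph on [N + r] vertices. *)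
Let XE : X = (k - 1) * (N * (N - 1)) + (N - 3) * (N + r) + 2 * (N + r).
Proof.
rewrite /X /p; case: k k_gt0 => // k' _; case: N N_ge4 => [|[|[|M]]] // _.
rewrite !(subSS, subn0); lia.
Qed.

Lemma ex_T2_le : ex p (T2 N.+1) <= maxn a b.
Proof.
apply/bigmax_leqP => G /andP[simpleG freeG].
have := T2_free_fork_free (n := N.+1) N_ge4 simpleG freeG; rewrite subn1 => ff.
have := fork_free_turan_bound (A := [set: 'I_p]) (adj_sym G) (adj_irr simpleG) N_ge4 ff rN.
rewrite vol_adj // cardsT card_ord => /(_ k erefl); rewrite -doubleb leq_max.
case=> [h|[_ h]]; first by apply/orP; right; lia.
apply/orP; left; rewrite /a XE; case: k k_gt0 h => // k' _; lia.
Qed.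

Lemma ex_T2_ge_cliques : b <= ex p (T2 N.+1).
Proof.
have N0 : 0 < N by lia.
have pp : (0 < p - p) || (p == p) by rewrite eqxx orbT.
apply: leq_trans (leq_ex (simple_blocks_circ p N p 0) _).
  rewrite (card_blocks_circ N0 (leqnn p) pp) mul0n div0n addn0.
  by rewrite -(leq_pmul2l (isT : 0 < 2)) doubleb -sum_modn.
by apply: (blocks_circ_T2_free N0 (leqnn p) pp) => //; lia.
Qed.

Lemma ex_T2_ge_circ : a <= ex p (T2 N.+1).
Proof.
have N0 : 0 < N by lia.
pose M := (k - 1) * N.
have pM : p - M = N + r.
  by rewrite /p /M; case: k k_gt0 => // k' _; rewrite subn1 /=; lia.
have Mp : M <= p by apply: leq_trans (leq_addr r _); rewrite leq_mul2r leq_subr orbT.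
have dm : (N - 3 < p - M) || (M == p) by rewrite pM; lia.
apply: leq_trans (leq_ex (simple_blocks_circ p N M (N - 3)) _).
  rewrite (card_blocks_circ N0 Mp dm) pM /a XE.
  have := sum_modn (k - 1) N0 N0; rewrite muln0 !addn0 -/M => <-.
  by move: (\sum_(_ < _) _) ((N - 3) * (N + r)) => S Z; lia.
by apply: (blocks_circ_T2_free N0 Mp dm) => //; lia.
Qed.

Lemma ex_T2 : ex p (T2 N.+1) = maxn a b.
Proof.
apply/eqP; rewrite eqn_leq ex_T2_le geq_max ex_T2_ge_circ.
exact: ex_T2_ge_cliques.
Qed.

(** The comparison is between [r * (N - r)] and [2 * (N + r)]. With [t = N - r] it asks whether
    [(r - 2) * (t - 4)] reaches 8, which explains the thresholds. *)
Lemma circ_vs_cliques :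
  if ((15 <= N) && (3 <= r <= N - 5)) || ((12 <= N <= 14) && (4 <= r <= N - 6))
  then b <= a else a <= b.
Proof.
case: ifP => cond.
  suff : 2 * (N + r) <= r * (N - r) by rewrite /a /b; lia.
  case/orP: cond => /andP[N1 /andP[r1 r2]].
    have [s rE] : exists s, r = s + 3 by exists (r - 3); lia.
    have [t tE] : exists t, N = r + (t + 5) by exists (N - r - 5); lia.
    rewrite tE addKn rE.
    have st : 7 <= s + t by lia.
    by have := leq0n (s * t); lia.
  have [s rE] : exists s, r = s + 4 by exists (r - 4); lia.
  have [t tE] : exists t, N = r + (t + 6) by exists (N - r - 6); lia.
  rewrite tE addKn rE.
  have st : 2 <= s + t by lia.
  by have := leq0n (s * t); lia.
suff : r * (N - r) <= 2 * (N + r) by rewrite /a /b; lia.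
have [t tE] : exists t, N = r + t by exists (N - r); lia.
rewrite {}tE in cond *; rewrite addKn.
have [r2|r3] := leqP r 2; first by case: (r) r2 => [|[|[|]]] //; lia.
have [t4|t5] := leqP t 4; first by case: t t4 {cond} => [|[|[|[|[|]]]]] //; lia.
(* With [r >= 3] and [t >= 5] the failed condition forces [N <= 14], so finitely many [r] remain;
   for each numeral the inequality is linear in [t]. *)
have r10 : r < 10 by lia.
move: r3 r10 cond t5; clear; move: r => q.
by do 10!(case: q => [|q]; first by lia).
Qed.

Lemma circ_size : N + r <= X %/ 2.
Proof. by rewrite XE leq_divRL // mulnC leq_addl. Qed.
End Extremal.

Theorem theorem3p1 (p n k r : nat) :
  (4 <= n - 1)%N -> (n - 1 <= p)%N ->
  (0 < k)%N -> p = (k * (n - 1) + r)%N -> (r <= n - 2)%N ->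
  let A : int := (Posz (((n - 2) * p) %/ 2) - Posz (n - 1 + r))%R in
  let B : int := Posz (((n - 2) * p - r * (n - 1 - r)) %/ 2) in
  Posz (ex p (T2 n)) = Num.max A B /\
  Posz (ex p (T2 n)) =
    (if ((16 <= n) && (3 <= r <= n - 6)) ||
        ((13 <= n <= 15) && (4 <= r <= n - 7))
     then A else B).
Proof.
case: n => // N; rewrite !subSS subn0 => N4 _ k0 -> rN A B.
have {}rN : r < N by lia.
(* By [circ_size] the integer difference is nonnegative and agrees with the truncated one. *)
have AE : A = Posz (((N - 1) * (k * N + r)) %/ 2 - (N + r)).
  by rewrite /A subzn //; have := circ_size N4 k0 rN; lia.
have := circ_vs_cliques N4 k0 rN; have := ex_T2 N4 k0 rN.
rewrite AE /B; move: (_ %/ 2 - (N + r)) ((_ - r * (N - r)) %/ 2) => a b ->.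
rewrite !ltnS; move: (_ || _) => c ab.
by split; [case: leP; lia|case: c ab; lia].
Qed.
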